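(* For even $n$, $f(n,C_4)=\frac{2^{n-1}}{3}\left(1+\Theta\left(\frac{1}{\sqrt n}\right)\right)$ (as $n\to\infty$ through even integers). Additionally, for all $n\ge 27$, $\frac{2^{n-1}}{3}\le f(n,C_4)\le \frac{2^{n-1}}{3}\left(1+O\left(\frac{1}{\sqrt n}\right)\right)$.
   Context: $[n]=\{1,\dots,n\}$ and $\mathcal{P}(n)$ is the set of all subsets of $[n]$. For a graph $G$, a hypergraph $H$ is called Berge-$G$ if there is a copy of $G$ with $V(G)\subseteq V(H)$ and a bijection $g:E(G)\to E(H)$ such that $e\subseteq g(e)$ for every $e\in E(G)$. A family of subsets of $[n]$ (viewed as a hypergraph with vertex set $[n]$) is $G$-free if it contains no subfamily that is a Berge-$G$ hypergraph. $f(n,G)$ denotes the smallest number of colors in a coloring (partition) of $\mathcal{P}(n)$ such that every color class is $G$-free. $C_4$ is the cycle with 4 edges. Here $\Theta(1/\sqrt n)$ denotes a quantity lying between $c_1/\sqrt n$ and $c_2/\sqrt n$ for some absolute constants $c_1,c_2>0$ and all sufficiently large $n$, and $O(1/\sqrt n)$ denotes a quantity at most $c/\sqrt n$ in absolute value for an absolute constant $c$. *)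

(* Defs.v *)
From mathcomp Require Import all_boot.

Set Implicit Arguments.
Unset Strict Implicit.
Unset Printing Implicit Defensive.

Record sgraph := SGraph {
  vertex : finType;
  edges : {set {set vertex}};
  edges_card2 : forall e, e \in edges -> #|e| = 2
}.

Definition C4_edges : {set {set 'I_4}} := [set [set i; ordS i] | i : 'I_4].

Lemma C4_edges_card2 e : e \in C4_edges -> #|e| = 2.
Proof.
case/imsetP=> i _ ->; rewrite cards2 -val_eqE /=.
by case: i => [[|[|[|[|]]]]].
Qed.

Definition C4 : sgraph := SGraph C4_edges_card2.

(* A hypergraph on the vertex type [T] is its set [H] of hyperedges. The map
   [phi] gives the copy of [G] inside [T], and [g] restricts to the bijection
   from the edges of [G] to [H]; its values outside [edges G] are irrelevant. *)
Definition Berge (G : sgraph) (T : finType) (H : {set {set T}}) : bool :=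
  [exists phi : {ffun vertex G -> T}, exists g : {ffun {set vertex G} -> {set T}},
    [&& injectiveb phi,
        dinjectiveb g (edges G),
        g @: edges G == H &
        [forall e in edges G, phi @: e \subset g e]]].

Definition Gfree (G : sgraph) (T : finType) (F : {set {set T}}) : bool :=
  ~~ [exists H : {set {set T}}, (H \subset F) && Berge G H].

Definition Gfree_partition (n : nat) (G : sgraph)
    (P : {set {set {set 'I_n}}}) : bool :=
  partition P [set: {set 'I_n}] && [forall F in P, Gfree G F].

(* The partition into singletons is the starting point of the [arg min]: it is
   admissible as soon as [G] has at least two edges, and [fP] below shows that
   [f n G] is then the minimum. *)
Definition f (n : nat) (G : sgraph) : nat :=
  #|[arg min_(P < [set [set A] | A : {set 'I_n}] | Gfree_partition G P) #|P| ]|.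

Lemma Gfree_partition_singletons n G : 1 < #|edges G| ->
  Gfree_partition G [set [set A] | A : {set 'I_n}].
Proof.
move=> G2; apply/andP; split.
  apply/and3P; split.
  - apply/eqP/setP=> A; rewrite inE; apply/bigcupP; exists [set A].
      exact: imset_f.
    exact: set11.
  - apply/trivIsetP=> _ _ /imsetP[A _ ->] /imsetP[B _ ->] neqAB.
    by rewrite disjoints1 inE; apply: contraNneq neqAB => ->.
  - apply/imsetP=> -[A _ /setP/(_ A)]; by rewrite !inE eqxx.
apply/forall_inP=> _ /imsetP[A _ ->]; apply/existsPn=> H.
apply/negP=> /andP[/subset_leq_card]; rewrite cards1 => H1.
case/existsP=> phi /existsP[g /and4P[_ /dinjectiveP inj_g /eqP defH _]].
by move: H1; rewrite -defH card_in_imset // leqNgt G2.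
Qed.

Lemma fP n G : 1 < #|edges G| ->
  (exists2 P : {set {set {set 'I_n}}}, Gfree_partition G P & #|P| = f n G) /\
  (forall P : {set {set {set 'I_n}}}, Gfree_partition G P -> f n G <= #|P|).
Proof.
move=> G2; rewrite /f; case: arg_minnP => [|P GP minP].
  exact: Gfree_partition_singletons.
by split=> //; exists P.
Qed.

Lemma card_C4_edges : #|edges C4| = 4.
Proof.
rewrite card_in_imset ?card_ord // => i j _ _ /setP eq_ij.
have := eq_ij i; have := eq_ij j; have := eq_ij (ordS i).
rewrite !inE -!val_eqE /=.
case: i {eq_ij} => [[|[|[|[|i]]]] //= ?]; case: j => [[|[|[|[|j]]]] //= ?] //;
  by move=> *; apply: val_inj.
Qed.

(* Main.v *)
Require Import Defs.
From mathcomp Require Import all_boot all_order all_algebra.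
From mathcomp Require Import reals.
From mathcomp Require Import zify ring lra.
Import Order.TTheory GRing.Theory Num.Theory.

(** A colour class contains on average at most six sets, and six is reached.

    Lower bound.  Call a set heavy if it has at least n/2 elements and strictly
    heavy if it has more.  Let n > 18, and call two sets tight if they share at
    most three points.  Pairs that are not tight never obstruct a Berge cycle,
    since distinct representatives can then be chosen greedily.  Three heavy
    sets cannot be pairwise tight (inclusion-exclusion), and four heavy sets
    that split into two non-tight pairs always carry a Berge-C4
    ([two_overlaps_cycle]).  So, if four heavy sets carry no Berge-C4, each of
    their three pairings contains a tight pair and these three pairs form no
    triangle: they form a star ([star_of_quadruple]).  Stars cannot be extended
    to five sets, and two leaves of a star cannot both be larger than the
    complement of its centre.  Hence a C4-free family has at most four heavy
    members, and at most three as soon as two of them are strictly heavy, so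
    that giving weight 2 to sets of size n/2 and weight 3 to larger ones leaves
    weight at most 9 in each class ([C4free_weight]).  The total weight of all
    sets is 3 * 2^(n-1), plus half of the number of sets of size exactly n/2
    ([f_C4_lower]).  This second term, present for even n only, is the gain of
    relative order 1/sqrt n.

    Upper bound.  If U, V are families of at most three sets each and every
    member of U is disjoint from every member of V, then U :|: V is C4-free: a
    Berge cycle would stay within U or within V.  In a chain
    u_0 < u_1 < u_2 < ... of sets of size at most n/2, this applies to
    {u_3t, u_(3t+1), u_(3t+2)} together with the complements of
    u_(3t+3), u_(3t+4), u_(3t+5).  These classes use up the chain and the
    complements of its members six at a time, up to a bounded loss per chain.
    Every set or its complement has size at most n/2, and P(n) is a disjoint
    union of 'C(n, n./2) symmetric chains, so the total loss is
    O('C(n, n./2)) = O(2^n / sqrt n) ([f_C4_upper]). *)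

Set Implicit Arguments.
Unset Strict Implicit.
Unset Printing Implicit Defensive.

(** * Berge cycles of length four *)

Section Cycle.
Variable T : finType.
Implicit Types (P Q : {set T}) (A B C D X Y Z V W : {set T}) (F : {set {set T}}).

(** A system of distinct representatives for two sets. *)
Definition sdr2 P Q := [exists x in P, exists y in Q, x != y].

(** The hyperedges A, B, C, D, in this cyclic order, support a Berge-C4 whose
    vertices are the representatives of the consecutive intersections. *)
Definition berge_cycle A B C D := exists x y z t,
  [/\ uniq [:: x; y; z; t], x \in A :&: B, y \in B :&: C,
      z \in C :&: D & t \in D :&: A].

Definition C4free F := forall A B C D, uniq [:: A; B; C; D] ->
  {subset [:: A; B; C; D] <= F} -> ~ berge_cycle A B C D.

Lemma C4_edgesE : C4_edges =
  [set [set ord0; ordS ord0]; [set ordS ord0; ordS (ordS ord0)];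
       [set ordS (ordS ord0); ordS (ordS (ordS ord0))];
       [set ordS (ordS (ordS ord0)); ord0]].
Proof.
apply/setP=> e; rewrite !inE; apply/imsetP/idP => [[i _ ->]|].
  have : i \in [:: ord0; ordS ord0; ordS (ordS ord0); ordS (ordS (ordS ord0))].
    by rewrite !inE -!val_eqE /=; case: i => [[|[|[|[|]]]]].
  have E : ordS (ordS (ordS (ordS ord0))) = ord0 :> 'I_4 by apply: val_inj.
  by rewrite !inE; case/or4P=> /eqP->; rewrite ?E eqxx ?orbT.
have E : ordS (ordS (ordS (ordS ord0))) = ord0 :> 'I_4 by apply: val_inj.
rewrite -!orbA; case/or4P=> /eqP->;
  [exists ord0 | exists (ordS ord0) | exists (ordS (ordS ord0))
  | exists (ordS (ordS (ordS ord0)))]; rewrite ?E //.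
Qed.

Lemma C4_edges_uniq : uniq
  [:: [set ord0; ordS ord0]; [set ordS ord0; ordS (ordS ord0)];
      [set ordS (ordS ord0); ordS (ordS (ordS ord0))];
      [set ordS (ordS (ordS ord0)); (ord0 : 'I_4)]].
Proof.
have : #|C4_edges| = 4 := card_C4_edges.
rewrite C4_edgesE => E4; apply/card_uniqP; rewrite -[size _]/4 -[RHS]E4.
by apply: eq_card => e; rewrite !inE !orbA.
Qed.

(** The i-th edge of C4 joins the vertices i and i+1, so the hyperedge assigned
    to it contains two consecutive vertices of the cycle and each vertex lies in
    two consecutive hyperedges. *)
Lemma GfreeP F : Gfree C4 F <-> C4free F.
Proof.
have:= C4_edges_uniq; have E := C4_edgesE.
set e0 := [set ord0; _] in E *; set e1 := [set _; ordS (ordS _)] in E *.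
set e2 := [set _; ordS (ordS (ordS _))] in E *; set e3 := [set _; ord0] in E *.
move=> ue; split=> [/existsPn Ffree A B C D uS sF [x [y [z [t [ux xAB yBC zCD tDA]]]]]|Ffree].
  (* The vertex 0 is t, in D and A, so that the edge {i, i+1} goes to the i-th
     of A, B, C, D. *)
  pose phi : {ffun 'I_4 -> T} := [ffun i : 'I_4 => nth x [:: t; x; y; z] i].
  pose g : {ffun {set 'I_4} -> {set T}} :=
    [ffun e => nth set0 [:: A; B; C; D] (index e [:: e0; e1; e2; e3])].
  have memE e : (e \in C4_edges) = (e \in [:: e0; e1; e2; e3]).
    by rewrite E !inE !orbA.
  have ginj : {in C4_edges &, injective g}.
    move=> a b; rewrite !memE => ain bin; rewrite !ffunE => /eqP.
    rewrite nth_uniq // ?[size _]/= ?(index_mem _ [:: e0; e1; e2; e3]) //.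
    by move/eqP/(congr1 (nth e0 [:: e0; e1; e2; e3])); rewrite !nth_index.
  have /negP := Ffree (g @: C4_edges); apply; apply/andP; split.
    apply/subsetP=> X /imsetP[e]; rewrite memE => ein ->; apply: sF.
    by rewrite ffunE mem_nth // [X in _ < X](_ : _ = size [:: e0; e1; e2; e3]) // index_mem.
  apply/existsP; exists phi; apply/existsP; exists g; apply/and4P; split.
  - apply/injectiveP=> i j; rewrite !ffunE => /eqP; rewrite nth_uniq ?ltn_ord //.
      by move/eqP/val_inj.
    by rewrite (perm_uniq (s2:= [:: x; y; z; t])) // -(perm_rot 1).
  - exact/dinjectiveP.
  - exact: eqxx.
  have [ph0 ph1 ph2 ph3] : [/\ phi ord0 = t, phi (ordS ord0) = x,
    phi (ordS (ordS ord0)) = y & phi (ordS (ordS (ordS ord0))) = z].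
    by rewrite !ffunE.
  have [gA gB gC gD] : [/\ g e0 = A, g e1 = B, g e2 = C & g e3 = D].
    by rewrite !ffunE; move: ue; rewrite /= !inE !negb_or -!andbA;
      case/and4P=> n1 n2 n3 /and4P[n4 n5 n6 _];
      rewrite !eqxx (negPf n1) (negPf n2) (negPf n3) (negPf n4) (negPf n5) (negPf n6).
  move: xAB yBC zCD tDA; rewrite !inE => /andP[xA xB] /andP[yB yC] /andP[zC zD] /andP[tD tA].
  apply/forall_inP=> e; rewrite memE !inE; case/or4P=> /eqP->;
    rewrite imsetU1 imset_set1 ?ph0 ?ph1 ?ph2 ?ph3 ?gA ?gB ?gC ?gD;
    by apply/subsetP=> u; rewrite !inE => /orP[]/eqP->.
apply/existsPn => H; apply/negP=> /andP[HF /existsP[phi /existsP[g]]].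
case/and4P=> /injectiveP phinj /dinjectiveP ginj /eqP defH /forall_inP sub.
have mE e : e \in [:: e0; e1; e2; e3] -> e \in C4_edges.
  by rewrite E !inE !orbA.
have pg e i : e \in [:: e0; e1; e2; e3] -> i \in e -> phi i \in g e.
  by move=> /mE/sub/subsetP s ie; apply: s; apply: imset_f.
apply: (Ffree (g e0) (g e1) (g e2) (g e3)).
- rewrite -[[:: g e0; _; _; _]]/(map g [:: e0; e1; e2; e3]) map_inj_in_uniq //.
  by move=> a b /mE ? /mE ?; apply: ginj.
- move=> X; rewrite -[[:: g e0; _; _; _]]/(map g [:: e0; e1; e2; e3]).
  case/mapP=> e /mE ee ->; apply: (subsetP HF); rewrite -defH; exact: imset_f.
exists (phi (ordS ord0)), (phi (ordS (ordS ord0))), (phi (ordS (ordS (ordS ord0)))), (phi ord0).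
split; rewrite ?in_setI ?pg ?inE ?eqxx ?orbT //.
by rewrite /= !inE !negb_or !(inj_eq phinj) -!val_eqE.
Qed.

End Cycle.

(** * C4-free families have few heavy members *)

Section HeavySets.
Variable T : finType.
Implicit Types (P Q S : {set T}) (A B C D X Y Z V W : {set T}) (F : {set {set T}}).

Lemma pick_fresh (S : {set T}) (s : seq T) : size s < #|S| ->
  exists2 x, x \in S & x \notin s.
Proof.
move=> sS; have /subsetPn[x xS xs] : ~~ (S \subset [set:: s]).
  by apply: contraL sS => /subset_leq_card h; rewrite -leqNgt (leq_trans h) // cardsE card_size.
by exists x => //; rewrite inE in xs.
Qed.

(** Greedy choice: a set with more than three elements always contains a point
    different from the other three representatives. *)
Lemma sdr2_extend P Q S S' : sdr2 P Q -> 3 < #|S| -> 3 < #|S'| ->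
  exists x y z t, [/\ uniq [:: x; y; z; t], x \in P, y \in Q, z \in S & t \in S'].
Proof.
case/exists_inP=> x xP /exists_inP[y yQ xy] S4 S'4.
have [z zS zn] := @pick_fresh S [:: x; y] (ltnW S4).
have [t tS tn] := @pick_fresh S' [:: x; y; z] S'4.
exists x, y, z, t; split=> //.
rewrite -[[:: x; y; z; t]]/(rcons (rcons [:: x; y] z) t) !rcons_uniq tn zn /=.
by rewrite inE xy.
Qed.

Lemma berge_cycle_adj A B C D : sdr2 (A :&: B) (B :&: C) ->
  3 < #|C :&: D| -> 3 < #|D :&: A| -> berge_cycle A B C D.
Proof. exact: sdr2_extend. Qed.

Lemma berge_cycle_opp A B C D : sdr2 (A :&: B) (C :&: D) ->
  3 < #|B :&: C| -> 3 < #|D :&: A| -> berge_cycle A B C D.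
Proof.
move=> s b c; have [x [y [z [t [u ? ? ? ?]]]]] := sdr2_extend s b c.
exists x, z, y, t; split=> //; rewrite (perm_uniq (s2 := [:: x; y; z; t])) //.
by rewrite perm_cons -[[:: z; y; t]]/([:: z] ++ [:: y] ++ [:: t]) perm_catCA.
Qed.

Lemma sdr2P P Q : P != set0 -> Q != set0 -> 1 < #|P :|: Q| -> sdr2 P Q.
Proof.
case/set0Pn=> p pP /set0Pn[q qQ] PQ.
have [pq|pq] := eqVneq p q; last first.
  by apply/exists_inP; exists p => //; apply/exists_inP; exists q.
rewrite -{q}pq in qQ.
have [r] := @pick_fresh (P :|: Q) [:: p] PQ; rewrite !inE => rPQ rp.
case/orP: rPQ => h; apply/exists_inP; [exists r | exists p] => //; apply/exists_inP.
  by exists p.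
by exists r => //; rewrite eq_sym.
Qed.

Lemma cardsU_neq A B : A != B -> (#|A| < #|A :|: B|) || (#|B| < #|A :|: B|).
Proof.
move=> AB; have sA := subsetUl A B; have sB := subsetUr A B.
rewrite !ltn_neqAle !(subset_leq_card sA, subset_leq_card sB) !andbT -negb_and.
apply: contra AB => /andP[/eqP a /eqP b].
have /eqP -> : A == A :|: B by rewrite eqEcard sA a leqnn.
by rewrite eq_sym eqEcard sB b leqnn.
Qed.

Definition heavy A := #|T| <= 2 * #|A|.
Definition sheavy A := #|T| < 2 * #|A|.
Definition tight A B := #|A :&: B| <= 3.

Lemma tightC A B : tight A B = tight B A.
Proof. by rewrite /tight setIC. Qed.

(** Two disjoint heavy sets are complements of each other. *)
Lemma heavy_disjoint_unique X Y Z : heavy X -> heavy Y -> heavy Z ->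
  X :&: Y = set0 -> Z :&: Y = set0 -> X = Z.
Proof.
rewrite /heavy => hX hY hZ XY ZY.
have E A : A :&: Y = set0 -> A \subset ~: Y by rewrite -disjoints_subset -setI_eq0 => ->.
have cY : #|Y| + #|~: Y| = #|T| := cardsC Y.
have EA A : #|T| <= 2 * #|A| -> A :&: Y = set0 -> A = ~: Y.
  by move=> hA AY; apply/eqP; rewrite eqEcard E //=; lia.
by rewrite (EA X) // (EA Z).
Qed.

(** Distinct sets of equal size have a strictly larger union; the resulting
    excess of a full element over n/2 is what forces two such unions to meet in
    at least two points. *)
Lemma heavy_setU X Z : heavy X -> heavy Z -> X != Z -> #|T|.+2 <= 2 * #|X :|: Z|.
Proof. by rewrite /heavy => hX hZ /cardsU_neq; lia. Qed.


(** Both cycles alternate between the two large overlaps X :&: Z and Y :&: V, and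
    fail only if an opposite pair of cross intersections has no distinct
    representatives.  If both failed, no cross intersection could be empty, for
    a heavy set disjoint from a heavy set Y is the complement of Y.  Then all
    cross intersections would reduce to one common point a, although X :|: Z and
    Y :|: V are so large that they share two points. *)
Lemma two_overlaps_cycle X Y Z V : uniq [:: X; Y; Z; V] ->
  heavy X -> heavy Y -> heavy Z -> heavy V -> ~~ tight X Z -> ~~ tight Y V ->
  berge_cycle Z Y V X \/ berge_cycle Z V Y X.
Proof.
rewrite /= !inE !negb_or -!andbA => /and4P[XY XZ XV /and4P[YZ YV ZV _]].
rewrite /tight -!ltnNge => hX hY hZ hV bXZ bYV.
have [d1|n1] := boolP (sdr2 (Z :&: Y) (V :&: X)).
  by left; apply: berge_cycle_opp.
have [d2|n2] := boolP (sdr2 (Z :&: V) (Y :&: X)).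
  by right; apply: berge_cycle_opp => //; rewrite setIC.
exfalso.
have eq1 b c : b \in Z :&: Y -> c \in V :&: X -> b = c.
  move=> bP cQ; apply/eqP; apply: contraNT n1 => bc.
  by apply/exists_inP; exists b => //; apply/exists_inP; exists c.
have eq2 d a : d \in Z :&: V -> a \in Y :&: X -> d = a.
  move=> dP aQ; apply/eqP; apply: contraNT n2 => da.
  by apply/exists_inP; exists d => //; apply/exists_inP; exists a.
have ne A B C : A != C -> heavy A -> heavy B -> heavy C -> A :&: B = set0 ->
    exists x, x \in C :&: B.
  move=> neq hA hB hC AB; apply/set0Pn; apply: contraNneq neq => CB0.
  exact/eqP/(heavy_disjoint_unique hA hB hC).
have [a aYX] : exists a, a \in Y :&: X.
  apply/set0Pn/eqP => YX0.
  have [c cVX] : exists c, c \in V :&: X by apply: (ne Y).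
  have [b bZY] : exists b, b \in Z :&: Y by apply: (ne X) => //; rewrite setIC.
  have bc := eq1 _ _ bZY cVX; have /setP/(_ b) := YX0; move: bZY cVX.
  by rewrite -bc !inE => /andP[_ ->] /andP[_ ->].
have [d dZV] : exists d, d \in Z :&: V.
  apply/set0Pn/eqP => ZV0.
  have [c cVX] : exists c, c \in V :&: X.
    by rewrite setIC; apply: (ne Z) => //; rewrite eq_sym.
  have [b bZY] : exists b, b \in Z :&: Y.
    by rewrite setIC; apply: (ne V); rewrite // ?(eq_sym V) // setIC.
  have bc := eq1 _ _ bZY cVX; have /setP/(_ b) := ZV0; move: bZY cVX.
  by rewrite -bc !inE => /andP[-> _] /andP[-> _].
(* Now every cross intersection is contained in {a}. *)
have da := eq2 _ _ dZV aYX; subst d.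
move: aYX dZV; rewrite !inE => /andP[aY aX] /andP[aZ aV].
have sub1 : (X :|: Z) :&: (Y :|: V) \subset [set a].
  apply/subsetP=> x; rewrite !inE => /andP[/orP[xX|xZ] /orP[xY|xV]]; apply/eqP.
  - by apply/esym/eq2; rewrite inE ?aZ ?xX ?xY.
  - by apply/esym/eq1; rewrite inE ?aZ ?aY ?xX ?xV.
  - by apply/eq1; rewrite inE ?aV ?aX ?xZ ?xY.
  - by apply/eq2; rewrite inE ?aY ?aX ?xZ ?xV.
have i1 := subset_leq_card sub1; rewrite cards1 in i1.
have uXZ := heavy_setU hX hZ XZ; have uYV := heavy_setU hY hV YV.
have ie := cardsUI (X :|: Z) (Y :|: V).
have uT : #|(X :|: Z) :|: (Y :|: V)| <= #|T| := max_card _.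
clear -i1 uXZ uYV ie uT; lia.
Qed.

(** By inclusion-exclusion, 3n/2 <= n + 9 otherwise. *)
Lemma three_tight X Y Z : 18 < #|T| -> heavy X -> heavy Y -> heavy Z ->
  tight X Y -> tight Y Z -> ~~ tight X Z.
Proof.
rewrite /heavy /tight -ltnNge => n18 hX hY hZ XY YZ.
have ie2 := cardsUI X Y; have ie3 := cardsUI (X :|: Y) Z.
have le : #|(X :|: Y) :&: Z| <= #|X :&: Z| + #|Y :&: Z|.
  by rewrite setIUl cardsU leq_subr.
have uT : #|X :|: Y :|: Z| <= #|T| := max_card _; lia.
Qed.

Section C4freeFamily.
Variable F : {set {set T}}.
Hypotheses (n18 : 18 < #|T|) (Ffree : C4free F).

(** Sequences rather than four separate sets, so that symmetries are applied by
    [perm_eq]. *)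
Definition heavy_members (s : seq {set T}) := [&& uniq s, all heavy s & all [in F] s].

Lemma heavy_members_perm s s' : perm_eq s s' -> heavy_members s -> heavy_members s'.
Proof.
by move=> pss; rewrite /heavy_members -(perm_uniq pss) -!(perm_all _ pss).
Qed.

Lemma heavy_members_no_cycle A B C D : heavy_members [:: A; B; C; D] ->
  ~ berge_cycle A B C D.
Proof. by case/and3P=> u _ /allP sF; apply: Ffree. Qed.

(** The first argument is the centre, the other three are the leaves. *)
Definition star Y X Z V := [/\ tight Y X, tight Y Z & tight Y V].

(** Each of the three pairings of four sets contains a tight pair.  Three edges
    of K_4, one from each perfect matching, form a triangle or a star, and
    tight triangles do not exist. *)
Lemma star_of_quadruple X Y Z V : heavy_members [:: X; Y; Z; V] ->
  [\/ star X Y Z V, star Y X Z V, star Z X Y V | star V X Y Z].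
Proof.
move=> hm; have pairing A B C D : perm_eq [:: X; Y; Z; V] [:: A; B; C; D] ->
    tight A C || tight B D.
  move=> pe; have hm' := heavy_members_perm pe hm.
  have /and3P[u /and5P[hA hB hC hD _] _] := hm'.
  apply/negPn/negP; rewrite negb_or => /andP[tAC tBD].
  by have [] := two_overlaps_cycle u hA hB hC hD tAC tBD;
    apply: heavy_members_no_cycle; apply: heavy_members_perm hm'; apply/permP=> p /=; clear; lia.
have p1 : tight X Z || tight Y V by apply: pairing; apply/permP=> p /=; clear; lia.
have p2 : tight X Y || tight Z V by apply: pairing; apply/permP=> p /=; clear; lia.
have p3 : tight X V || tight Y Z by apply: pairing; apply/permP=> p /=; clear; lia.
have /and3P[_ /and5P[hX hY hZ hV _] _] := hm.
have no3 A B C : heavy A -> heavy B -> heavy C -> ~~ [&& tight A B, tight B C & tight A C].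
  move=> hA hB hC; apply/and3P=> -[AB BC].
  exact/negP/(three_tight n18 hA hB hC AB BC).
have:= no3 X Y Z hX hY hZ; have:= no3 X Y V hX hY hV.
have:= no3 X Z V hX hZ hV; have:= no3 Y Z V hY hZ hV.
rewrite /star !(tightC _ X) !(tightC Z Y) !(tightC V Y) !(tightC V Z).
case/orP: p1 => ->; case/orP: p2 => ->; case/orP: p3 => ->; rewrite ?andbT /=;
  first [by [] | move=> _ _ _ _].
- by constructor 1.
- by constructor 3.
- by constructor 2.
- by constructor 4.
Qed.

Lemma heavy_members_behead X s : heavy_members (X :: s) -> heavy_members s.
Proof. by case/and3P=> /andP[_ u] /andP[_ h] /andP[_ sF]; apply/and3P. Qed.

(** Applied to Y, X, Z and the fifth set W, [star_of_quadruple] can only give a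
    star centred at Y or at W, so W is tight to Y too.  The four sets X, Z, V, W
    are then pairwise non-tight, which contradicts the same lemma. *)
Lemma star_no_fifth Y X Z V W :
  heavy_members [:: Y; X; Z; V; W] -> ~ star Y X Z V.
Proof.
move=> hm [YX YZ YV].
have /and3P[_ /and5P[hY hX hZ hV /andP[hW _]] _] := hm.
have fan A B : heavy A -> heavy B -> tight Y A -> tight Y B -> ~~ tight A B.
  by move=> hA hB YA YB; apply: (three_tight n18 hA hY hB); rewrite // tightC.
have hmYXZW : heavy_members [:: Y; X; Z; W].
  apply: (@heavy_members_behead V); apply: heavy_members_perm hm.
  by apply/permP=> p /=; clear; lia.
have YW : tight Y W.
  have nXZ := fan _ _ hX hZ YX YZ.
  case: (star_of_quadruple hmYXZW) => -[] //; last by rewrite (tightC W).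
    by rewrite (negPf nXZ).
  by rewrite [tight Z X]tightC (negPf nXZ).
have nt := fan _ _ hX hZ YX YZ; have nt' := fan _ _ hX hV YX YV.
have nt2 := fan _ _ hV hW YV YW.
case: (star_of_quadruple (heavy_members_behead hm)) => -[].
- by rewrite (negPf nt).
- by rewrite tightC (negPf nt).
- by rewrite tightC (negPf nt').
- by rewrite tightC => _ _; rewrite tightC (negPf nt2).
Qed.

Lemma no_five_heavy s : heavy_members s -> size s <= 4.
Proof.
case: s => [|X [|Z [|V [|W [|U s]]]]] // hm; exfalso.
have {}hm : heavy_members [:: X; Z; V; W; U].
  elim: s hm => // A s IH hm; apply: IH; apply: (@heavy_members_behead A).
  apply: heavy_members_perm hm; rewrite -cat1s.
  by apply/permP=> p /=; clear; lia.
have hm4 : heavy_members [:: X; Z; V; W].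
  apply: (@heavy_members_behead U); apply: heavy_members_perm hm.
  by apply/permP=> p /=; clear; lia.
case: (star_of_quadruple hm4); apply: star_no_fifth (heavy_members_perm _ hm);
  by apply/permP=> p /=; clear; lia.
Qed.

(** If both leaves X and Z were larger than the complement of Y, then Y would meet
    X :|: Z in two points, since X and Z are distinct; this gives distinct
    representatives for Y :&: X and Y :&: Z, and the third leaf V, which
    overlaps X and Z widely, closes the cycle Z, Y, X, V. *)
Lemma star_leaves_small Y X Z V : heavy_members [:: Y; X; Z; V] ->
  star Y X Z V -> #|T| < #|Y| + #|X| -> #|Y| + #|Z| <= #|T|.
Proof.
move=> hm [YX YZ YV] bYX; rewrite leqNgt; apply/negP=> bYZ.
have /and3P[u /and5P[hY hX hZ hV _] _] := hm.
have nXZ : X != Z by move: u; rewrite /= !inE !negb_or -!andbA => /and5P[_ _ _ ? _].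
have fan A : heavy A -> tight Y A -> ~~ tight V A.
  by move=> hA YA; apply: (three_tight n18 hV hY hA); rewrite // tightC.
have bXV : 3 < #|X :&: V| by rewrite ltnNge -/(tight X V) tightC fan.
have bVZ : 3 < #|V :&: Z| by rewrite ltnNge -/(tight V Z) fan.
have d : sdr2 (Z :&: Y) (Y :&: X).
  have meet A : #|T| < #|Y| + #|A| -> Y :&: A != set0.
    move=> YA; apply/eqP=> YA0; have := cardsUI Y A; rewrite YA0 cards0.
    have uT : #|Y :|: A| <= #|T| := max_card _.
    by clear -YA uT; lia.
  apply: sdr2P; rewrite ?(setIC Z) ?meet //.
  rewrite -setIUr; have ie := cardsUI Y (Z :|: X).
  have uT : #|Y :|: (Z :|: X)| <= #|T| := max_card _.
  have lt := cardsU_neq nXZ; rewrite setUC in lt.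
  clear -ie uT lt bYX bYZ; lia.
apply: (@heavy_members_no_cycle Z Y X V); last exact: berge_cycle_adj.
by apply: heavy_members_perm hm; apply/permP=> p /=; clear; lia.
Qed.

(** Two strictly heavy sets in a star would yield two leaves as excluded by
    [star_leaves_small]: any two leaves if the centre is one of them, else these
    two sets themselves. *)
Lemma star_sheavy Y X Z V : heavy_members [:: Y; X; Z; V] ->
  star Y X Z V -> sheavy Y + sheavy X + sheavy Z + sheavy V <= 1.
Proof.
move=> hm [YX YZ YV]; have /and3P[_ /and5P[hY hX hZ hV _] _] := hm.
have sXZ := star_leaves_small hm (And3 YX YZ YV).
have sXV : #|T| < #|Y| + #|X| -> #|Y| + #|V| <= #|T|.
  apply: (@star_leaves_small Y X V Z); last by split.
  by apply: heavy_members_perm hm; apply/permP=> p /=; clear; lia.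
have sZV : #|T| < #|Y| + #|Z| -> #|Y| + #|V| <= #|T|.
  apply: (@star_leaves_small Y Z V X); last by split.
  by apply: heavy_members_perm hm; apply/permP=> p /=; clear; lia.
move: sXZ sXV sZV hY hX hZ hV; rewrite /heavy /sheavy; clear.
move: #|T| #|Y| #|X| #|Z| #|V| => n y x z v; lia.
Qed.

Lemma quadruple_sheavy s : heavy_members s -> size s = 4 -> count sheavy s <= 1.
Proof.
case: s => [|X [|Z [|V [|W [|U s]]]]] // hm _.
case: (star_of_quadruple hm) => st.
- have := star_sheavy hm st; rewrite /=; clear; lia.
- have := star_sheavy (heavy_members_perm _ hm) st.
  have pe : perm_eq [:: X; Z; V; W] [:: Z; X; V; W] by apply/permP=> p /=; clear; lia.
  move/(_ pe); rewrite /=; clear; lia.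
- have := star_sheavy (heavy_members_perm _ hm) st.
  have pe : perm_eq [:: X; Z; V; W] [:: V; X; Z; W] by apply/permP=> p /=; clear; lia.
  move/(_ pe); rewrite /=; clear; lia.
- have := star_sheavy (heavy_members_perm _ hm) st.
  have pe : perm_eq [:: X; Z; V; W] [:: W; X; Z; V] by apply/permP=> p /=; clear; lia.
  move/(_ pe); rewrite /=; clear; lia.
Qed.

(** The weight is 2 for sets of size n/2 and 3 for larger ones.  The value 9 is
    attained by three strictly heavy sets, and by one together with three sets
    of size n/2. *)
Lemma C4free_weight : \sum_(A in F) (2 * heavy A + sheavy A) <= 9.
Proof.
have hm : heavy_members (enum [set A in F | heavy A]).
  rewrite /heavy_members enum_uniq /=; apply/andP; split; apply/allP=> A;
    by rewrite mem_enum inE => /andP[].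
have sheavy_heavy A : sheavy A -> heavy A by apply: ltnW.
have := quadruple_sheavy hm; have := no_five_heavy hm.
rewrite -cardE big_split /= -big_distrr /=.
have -> : count sheavy (enum [set A in F | heavy A]) = \sum_(A in F) sheavy A.
  rewrite -sum1_count big_enum_cond /= big_mkcondr /= big_mkcond /=.
  rewrite [RHS]big_mkcond; apply: eq_bigr => A _; rewrite inE.
  by case: (A \in F) => //=; case: (sheavy A) (sheavy_heavy A) => [/(_ isT) ->|_] //; case: (heavy A).
have -> : #|[set A in F | heavy A]| = \sum_(A in F) heavy A.
  rewrite -sum1_card big_mkcond [RHS]big_mkcond; apply: eq_bigr => A _; rewrite inE.
  by case: (A \in F) => //=; case: (heavy A).
have : \sum_(A in F) sheavy A <= \sum_(A in F) heavy A.
  by apply: leq_sum => A _; case: (sheavy A) (sheavy_heavy A) => [/(_ isT) ->|].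
clear; move: (\sum_(A in F) heavy A) (\sum_(A in F) sheavy A) => h b; lia.
Qed.

End C4freeFamily.
End HeavySets.

(** * The lower bound *)

Lemma card_set_sum (U : finType) (p : pred U) : #|[set A | p A]| = \sum_A p A.
Proof.
rewrite -sum1_card big_mkcond; apply: eq_bigr => A _; rewrite inE.
by case: (p A).
Qed.

Section Layers.
Variable T : finType.
Implicit Types (A : {set T}) (F : {set {set T}}).

Lemma heavy_setC A : heavy (~: A) = ~~ sheavy A.
Proof. by rewrite /heavy /sheavy; have := cardsC A; lia. Qed.

Lemma card_nonsheavy : #|[set A : {set T} | ~~ sheavy A]| = #|[set A : {set T} | heavy A]|.
Proof.
rewrite -[RHS](card_imset _ (@setC_inj T)); apply: eq_card => A.
by rewrite !inE -{2}[A]setCK (mem_imset _ _ (@setC_inj T)) inE heavy_setC.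
Qed.

Lemma card_heavy_sheavy :
  #|[set A : {set T} | heavy A]| + #|[set A : {set T} | sheavy A]| = 2 ^ #|T|.
Proof.
rewrite -card_nonsheavy addnC -[in RHS]cardsT -card_powerset powersetT cardsT.
by rewrite -(cardsC [set A : {set T} | sheavy A]); congr (_ + _); apply: eq_card => A; rewrite !inE.
Qed.

Definition middle A := 2 * #|A| == #|T|.

Lemma card_heavy_middle : #|[set A : {set T} | heavy A]| =
  #|[set A : {set T} | sheavy A]| + #|[set A : {set T} | middle A]|.
Proof.
rewrite -cardsUI (_ : _ :&: _ = set0) ?cards0 ?addn0.
  by apply: eq_card => A; rewrite !inE /heavy /sheavy /middle; lia.
by apply/setP=> A; rewrite !inE /sheavy /middle; lia.
Qed.

Lemma card_layer k : #|[set A : {set T} | #|A| == k]| = 'C(#|T|, k).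
Proof. exact: card_draws. Qed.

Lemma card_middle : #|[set A : {set T} | middle A]| =
  if odd #|T| then 0 else 'C(#|T|, #|T|./2).
Proof.
rewrite -card_layer; have := odd_double_half #|T|; rewrite /middle.
case: odd => E; last by apply: eq_card => A; rewrite !inE; lia.
by apply/eqP; rewrite cards_eq0; apply/eqP/setP=> A; rewrite !inE; lia.
Qed.

End Layers.

(** The weights of [C4free_weight], summed over all sets and bounded class by
    class. *)
Lemma f_C4_lower n : 18 < n ->
  3 * 2 ^ n + (if odd n then 0 else 'C(n, n./2)) <= 18 * f n C4.
Proof.
move=> n18; have C2 : 1 < #|edges C4| by rewrite card_C4_edges.
have [[P /andP[/and3P[/eqP covP triv _] /forall_inP free] <-] _] := fP n C2.
have hb := card_heavy_sheavy 'I_n; have hm := card_heavy_middle 'I_n.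
rewrite card_middle card_ord in hm; rewrite card_ord in hb.
suff : 2 * #|[set A : {set 'I_n} | heavy A]| + #|[set A : {set 'I_n} | sheavy A]| <= 9 * #|P|.
  by move: hb hm; case: odd; clear; lia.
have wE : 2 * #|[set A : {set 'I_n} | heavy A]| + #|[set A : {set 'I_n} | sheavy A]| =
   \sum_(A : {set 'I_n}) (2 * heavy A + sheavy A).
  by rewrite big_split /= -big_distrr /= !card_set_sum.
have -> : 2 * #|[set A : {set 'I_n} | heavy A]| + #|[set A : {set 'I_n} | sheavy A]| =
    \sum_(F in P) \sum_(A in F) (2 * heavy A + sheavy A).
  by rewrite -big_trivIset // covP wE; apply: eq_bigl => A; rewrite inE.
rewrite mulnC -sum_nat_const; apply: leq_sum => F FP.
by apply: C4free_weight; [rewrite card_ord | apply/GfreeP/free].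
Qed.


(** * Coverings by C4-free families *)

(** C4-freeness passes to subfamilies, so a covering can be refined to a
    partition by sending each set to the first family that contains it. *)
Lemma f_le_cover n (L : seq {set {set 'I_n}}) :
  {in L, forall F, C4free F} -> (forall A, has (fun F : {set {set 'I_n}} => A \in F) L) ->
  f n C4 <= size L.
Proof.
move=> free cov; pose col A := find (fun F : {set {set 'I_n}} => A \in F) L.
have C2 : 1 < #|edges C4| by rewrite card_C4_edges.
have [_ minf] := fP n C2.
have PE F : F \in preim_partition col [set: {set 'I_n}] ->
    exists2 i : 'I_(size L), F = [set A | col A == i] & F \subset nth set0 L i.
  case/imsetP=> A _ ->; have lt : col A < size L by rewrite -has_find cov.
  exists (Ordinal lt); first by apply/setP=> B; rewrite !inE eq_sym.
  apply/subsetP=> B; rewrite !inE => /eqP /= ->.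
  exact: (nth_find set0 (cov B)).
apply: (leq_trans (minf (preim_partition col [set: {set 'I_n}]) _)).
  rewrite /Gfree_partition preim_partitionP; apply/forall_inP=> F /PE[i _ sF].
  apply/GfreeP=> A B C D u sub; apply: (free (nth set0 L i)) => //.
    by rewrite mem_nth.
  by move=> X /sub; apply: (subsetP sF).
rewrite -[leqRHS]card_ord -cardsT.
apply: leq_trans (leq_imset_card (fun i : 'I_(size L) => [set A | col A == i]) _).
by apply/subset_leq_card/subsetP=> F /PE[i -> _]; apply: imset_f.
Qed.

(** * Symmetric chain decompositions *)

Section Chains.
Variable T : finType.
Implicit Types (A B : {set T}) (F U V : {set {set T}}) (c l : seq {set T}).

Definition subset_rel : rel {set T} := fun A B => A \subset B.

(** The sizes of the members are consecutive and run from r to m - r, so that the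
    chain has m + 1 - 2r members. *)
Definition symmetric_chain m c := sorted subset_rel c /\
  exists2 r, map (fun A => #|A|) c = iota r (size c) & 0 < size c /\ 2 * r + size c = m.+1.

(** A chain A_0, ..., A_h gives, after the addition of a new point x to the ground
    set, the chains A_0, ..., A_h, x |: A_h and x |: A_0, ..., x |: A_(h-1).  The
    second one is empty if h = 0. *)
Definition chain_step x c : seq (seq {set T}) :=
  if c is A :: c' then
    [:: rcons c (x |: last A c'); map (setU [set x]) (belast A c')]
  else [::].

Lemma chain_step_symmetric x m c : {in c, forall A, x \notin A} ->
  symmetric_chain m c ->
  {in chain_step x c, forall d, d != [::] -> symmetric_chain m.+1 d}.
Proof.
case: c => // A c xc [sc [r rk [_ rm]]] d; rewrite !inE => /orP[]/eqP-> ne.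
  split.
    by rewrite /= rcons_path; apply/andP; split; [exact: sc | exact: subsetUr].
  exists r; last by rewrite size_rcons; split=> //; move: rm; rewrite /=; lia.
  rewrite map_rcons rk size_rcons -[in RHS]addn1 iotaD cats1; congr rcons.
  have -> : #|x |: last A c| = #|last A c|.+1 by rewrite cardsU1 xc ?mem_last.
  rewrite -[#|last A c|]/((fun B : {set T} => #|B|) (last A c)) -last_map.
  have -> : last #|A| (map (fun B : {set T} => #|B|) c) =
    last 0 (map (fun B : {set T} => #|B|) (A :: c)) by [].
  by rewrite rk -nth_last size_iota nth_iota //= addnS.
split.
  have /= : sorted subset_rel (rcons (belast A c) (last A c)) by rewrite -lastI.
  rewrite -cats1 => /cat_sorted2[sb _]; rewrite sorted_map.
  apply: sub_sorted sb => B B' BB'; exact: setUS.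
have sb : size (map (setU [set x]) (belast A c)) = size c by rewrite size_map size_belast.
exists r.+1; last first.
  rewrite sb; split; last by move: rm; rewrite /=; lia.
  by move: ne; rewrite -size_eq0 sb lt0n.
have : map (fun B : {set T} => #|B|) (belast A c) = iota r (size c).
  have := rk; rewrite lastI map_rcons size_rcons size_belast.
  by rewrite -[(size c).+1]addn1 iotaD /= cats1 => /rcons_inj[].
rewrite sb -[r.+1]add1n iotaDl => <-; rewrite -!map_comp; apply/eq_in_map => B Bc /=.
by rewrite cardsU1 xc // mem_belast.
Qed.

Lemma perm_chain_step x c :
  perm_eq (flatten (chain_step x c)) (c ++ map (setU [set x]) c).
Proof.
case: c => // A c.
have -> : map (setU [set x]) (A :: c) =
    map (setU [set x]) (belast A c) ++ [:: x |: last A c].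
  by rewrite lastI map_rcons cats1.
by rewrite /= cats0 -cats1 -catA perm_cons perm_cat2l perm_catC.
Qed.

(** Induction on the ground set (de Bruijn, Tengbergen and Kruyswijk). *)
Lemma symmetric_chain_decomposition (s : seq T) : uniq s ->
  exists2 C : seq (seq {set T}),
    {in C, forall c, symmetric_chain (size s) c} &
    perm_eq (flatten C) (enum (powerset [set:: s])).
Proof.
elim: s => [|x s IH] /=.
  move=> _; exists [:: [:: set0]].
    move=> c; rewrite inE => /eqP->; split=> //; exists 0 => //=.
    by rewrite cards0.
  rewrite set_nil powerset0 enum_set1; exact: perm_refl.
case/andP=> xs /IH[C symC permC].
have xC A : A \in flatten C -> x \notin A.
  rewrite (perm_mem permC) mem_enum powersetE => /subsetP sA.
  by apply: contra xs => /sA; rewrite inE.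
have inC c A : c \in C -> A \in c -> A \in flatten C.
  by move=> cC Ac; apply/flattenP; exists c.
exists [seq d <- flatten (map (chain_step x) C) | d != [::]].
  move=> d; rewrite mem_filter => /andP[ne /flatten_mapP[c cC dc]].
  apply: (chain_step_symmetric _ (symC c cC) dc) => // A Ac.
  exact/xC/(inC c).
have -> (L : seq (seq {set T})) : flatten [seq d <- L | d != [::]] = flatten L.
  by elim: L => //= -[|B d] L IHL /=; rewrite IHL.
have step : perm_eq (flatten (flatten (map (chain_step x) C)))
    (flatten C ++ map (setU [set x]) (flatten C)).
  elim: C {symC permC xC inC} => //= c C IHC.
  rewrite flatten_cat map_cat; apply: perm_trans (perm_cat (perm_chain_step x c) IHC) _.
  by rewrite -!catA perm_cat2l perm_catCA.
apply: perm_trans step _; have uC : uniq (flatten C).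
  by rewrite (perm_uniq permC) enum_uniq.
apply: uniq_perm; rewrite ?enum_uniq //.
  rewrite cat_uniq uC map_inj_in_uniq ?uC ?andbT //=.
    apply/hasPn=> _ /mapP[A AC ->]; apply/negP=> /xC.
    by rewrite !inE eqxx.
  move=> A B /xC xA /xC xB /(congr1 (fun D => D :\ x)).
  by rewrite !setU1K.
move=> A; rewrite mem_cat mem_enum powersetE (perm_mem permC) mem_enum powersetE.
have [xA|xA] := boolP (x \in A).
  have -> : (A \subset [set:: s]) = false.
    by apply/negP=> /subsetP/(_ x xA); rewrite inE (negPf xs).
  apply/mapP/idP => [[B + ->]|sA].
    rewrite (perm_mem permC) mem_enum powersetE => sB.
    by apply/subsetP=> y; rewrite !inE => /orP[->//|/(subsetP sB)]; rewrite inE => ->; rewrite orbT.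
  exists (A :\ x); last by rewrite setD1K.
  rewrite (perm_mem permC) mem_enum powersetE; apply/subsetP=> y.
  by rewrite !inE => /andP[/negPf yx /(subsetP sA)]; rewrite !inE yx.
have -> : (A \in map (setU [set x]) (flatten C)) = false.
  by apply/negP=> /mapP[B _ AB]; rewrite AB !inE eqxx in xA.
rewrite orbF; apply/subsetP/subsetP => h y yA; have := h y yA; rewrite !inE.
  by move->; rewrite orbT.
by case/orP=> // /eqP yx; rewrite -yx yA in xA.
Qed.

(** * The upper bound *)

(** Consecutive hyperedges of a Berge cycle meet, so all four would lie on the
    side of the first. *)
Lemma two_sides_C4free U V : #|U| <= 3 -> #|V| <= 3 ->
  (forall A B, A \in U -> B \in V -> A :&: B = set0) -> C4free (U :|: V).
Proof.
move=> U3 V3 UV A B C D u sub [x [y [z [t [_ xAB yBC zCD tDA]]]]].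
have closed (W W' : {set {set T}}) : (forall A B, A \in W -> B \in W' -> A :&: B = set0) ->
    {subset [:: A; B; C; D] <= W :|: W'} -> #|W| <= 3 -> A \notin W.
  move=> WW' sW W3; apply/negP => AW.
  have next X Y w : w \in X :&: Y -> X \in W -> Y \in [:: A; B; C; D] -> Y \in W.
    move=> wXY XW /sW; rewrite inE => /orP[//|/(WW' X Y XW) XY0].
    by move: wXY; rewrite XY0 inE.
  have BW : B \in W by apply: (next A B x); rewrite // !inE eqxx ?orbT.
  have CW : C \in W by apply: (next B C y); rewrite // !inE eqxx ?orbT.
  have DW : D \in W by apply: (next C D z); rewrite // !inE eqxx ?orbT.
  have : size [:: A; B; C; D] <= size (enum W).
    apply: uniq_leq_size => // X; rewrite mem_enum !inE.
    by case/or4P=> /eqP->.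
  by rewrite -cardE ltnNge W3.
have : A \in U :|: V by apply: sub; rewrite inE eqxx.
rewrite inE (negPf (closed U V UV sub U3)) /= (negPf (closed V U _ _ V3)) //.
  by move=> X Y XV YU; rewrite setIC UV.
by move=> X /sub; rewrite setUC.
Qed.

(** The t-th block of three complements is paired with the previous block of three
    sets, all contained in the complemented ones.  For t = 0 only complements
    occur. *)
Definition chain_class l t :=
  [set A | (A \in l) && ((index A l %/ 3).+1 == t)]
  :|: [set A | (~: A \in l) && (index (~: A) l %/ 3 == t)].

Lemma chain_class_C4free l t : sorted subset_rel l -> C4free (chain_class l t).
Proof.
move=> sl; have three k : #|[set A | (A \in l) && (index A l %/ 3 == k)]| <= 3.
  pose g A : 'I_3 := inord (index A l %% 3).
  have g_inj : {in [set A | (A \in l) && (index A l %/ 3 == k)] &, injective g}.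
    move=> A B; rewrite !inE => /andP[Al /eqP Ak] /andP[Bl /eqP Bk] /(congr1 (@nat_of_ord 3)).
    rewrite /g !inordK ?ltn_mod // => AB; apply: (index_inj A Al Bl).
    by rewrite /= (divn_eq (index A l) 3) (divn_eq (index B l) 3) Ak Bk AB.
  by rewrite -(card_in_imset g_inj) -[leqRHS](card_ord 3) max_card.
apply: two_sides_C4free.
- case: t => [|t]; last by rewrite (eq_card (_ : _ =i [set A | (A \in l) && (index A l %/ 3 == t)])).
  by rewrite (eq_card (_ : _ =i set0)) ?cards0 // => A; rewrite !inE andbF.
- rewrite -(card_imset _ (@setC_inj T)); apply: leq_trans (three t).
  apply/subset_leq_card/subsetP=> _ /imsetP[A + ->]; by rewrite !inE.
move=> A B; rewrite !inE => /andP[Al /eqP At] /andP[Bl /eqP Bt].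
apply/eqP; rewrite setI_eq0 disjoints_subset.
have tr : transitive subset_rel by move=> X Y Z; apply: subset_trans.
apply: (sorted_leq_index tr (fun X => subxx X) sl) => //.
by rewrite leqNgt; apply/negP => /ltnW/(leq_div2r 3); rewrite Bt -ltnS At ltnn.
Qed.

End Chains.

(** The sizes along the chain form an interval symmetric about m/2. *)
Lemma count_symmetric_chain (T : finType) m (c : seq {set T}) :
  symmetric_chain m c -> count (fun A : {set T} => #|A| == m./2) c = 1.
Proof.
case=> _ [r rk [c0 rm]].
rewrite -[LHS](count_map (fun A : {set T} => #|A|) (pred1 m./2)) rk.
rewrite count_uniq_mem ?iota_uniq // mem_iota.
have -> : r <= m./2 < r + size c by lia.
by [].
Qed.

(** A chain with k members of size at most n/2 contributes k %/ 3 + 2 classes.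
    There are 'C(n, n./2) chains, one for each set of size n./2, and the values k
    add up to 2 ^ (n-1) plus half of the number of sets of size exactly n/2. *)
Lemma f_C4_upper n : 6 * f n C4 <= 2 ^ n + 13 * 'C(n, n./2).
Proof.
have [C symC permC] := symmetric_chain_decomposition (enum_uniq 'I_n).
rewrite -cardE card_ord in symC.
have {}permC : perm_eq (flatten C) (enum {set 'I_n}).
  apply: perm_trans permC _; apply: uniq_perm; rewrite ?enum_uniq // => A.
  rewrite !mem_enum powersetE; apply/subsetP=> x _; by rewrite inE mem_enum.
have countC (p : pred {set 'I_n}) : \sum_(c <- C) count p c = #|[set A | p A]|.
  have := permP permC p; rewrite count_flatten sumnE big_map => ->.
  rewrite -sum1_count big_enum_cond /= -sum1_card.
  by apply: eq_bigl => A; rewrite !inE.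
have sizeC : size C = 'C(n, n./2).
  rewrite -[in RHS](card_ord n) -card_layer -countC -sum1_size.
  by apply: eq_big_seq => c /symC/count_symmetric_chain; rewrite card_ord => ->.
pose low := fun A : {set 'I_n} => ~~ sheavy A.
pose classes c := [seq chain_class (filter low c) t | t <- iota 0 (count low c %/ 3).+2].
have cov : f n C4 <= size (flatten (map classes C)).
  have tr : transitive (@subset_rel 'I_n) by move=> X Y Z; apply: subset_trans.
  apply: f_le_cover => [F /flatten_mapP[c cC /mapP[t _ ->]]|A].
    apply: chain_class_C4free; apply: sorted_filter => //.
    by case: (symC c cC).
  have inC S : exists2 c, c \in C & S \in c.
    by apply/flattenP; rewrite (perm_mem permC) mem_enum.
  have put S t : low S -> (forall c, c \in C -> S \in filter low c ->
      t c <= (index S (filter low c) %/ 3).+1 /\ A \in chain_class (filter low c) (t c)) ->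
      has (fun F : {set {set 'I_n}} => A \in F) (flatten (map classes C)).
    move=> lowS h; have [c cC Sc] := inC S.
    have Sl : S \in filter low c by rewrite mem_filter lowS.
    have [tc At] := h c cC Sl; apply/hasP; exists (chain_class (filter low c) (t c)) => //.
    apply/flatten_mapP; exists c => //; apply: map_f.
    rewrite mem_iota add0n /= (leq_ltn_trans tc) // !ltnS leq_div2r //.
    by apply: ltnW; rewrite -size_filter index_mem.
  have [lA|lA] := boolP (low A).
    apply: (put A (fun c => (index A (filter low c) %/ 3).+1)) => // c cC Al.
    by split=> //; rewrite !inE Al eqxx.
  (* A large set is the complement of a member of some chain. *)
  have lCA : low (~: A).
    by rewrite /low -heavy_setC setCK; move: lA; rewrite /low negbK; apply: ltnW.
  apply: (put (~: A) (fun c => index (~: A) (filter low c) %/ 3)) => // c cC Al.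
  by split=> //; rewrite !inE Al eqxx orbT.
have sz : 3 * size (flatten (map classes C)) <= #|[set A : {set 'I_n} | low A]| + 6 * size C.
  rewrite size_flatten /shape -map_comp sumnE big_map -countC -sum1_size.
  rewrite !big_distrr -big_split /=; apply: leq_sum => c _.
  rewrite size_map size_iota; have := leq_divM (count low c) 3; lia.
have hb := card_heavy_sheavy 'I_n; have hm := card_heavy_middle 'I_n.
rewrite card_middle card_ord in hm; rewrite card_ord in hb.
move: sz cov hb hm; rewrite [in X in X -> _]/low card_nonsheavy sizeC.
move: (size _) #|_| #|_| (2 ^ n) (f n C4) => s h g N k.
by case: odd; move: ('C(n, n./2)) => b; clear; lia.
Qed.


(** * Central binomial coefficients *)

Lemma central_bin_half k : 'C(k.+1.*2, k.+1) = 2 * 'C(k.*2.+1, k.+1).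
Proof.
have s : 'C(k.*2.+1, k) = 'C(k.*2.+1, k.+1).
  by rewrite -[RHS]bin_sub -?addnn; [congr 'C(_, _); lia | lia].
by rewrite doubleS binS s mul2n addnn.
Qed.

Lemma central_binS k : k.+1 * 'C(k.+1.*2, k.+1) = (2 * k.*2.+1) * 'C(k.*2, k).
Proof.
by rewrite central_bin_half mulnCA -mul_bin_diag /= mulnA.
Qed.

(** Together with [central_bin_ge]: 4 ^ k / sqrt (4k) <= 'C(2k, k) <=
    4 ^ k / sqrt (2k+1).  Squared, both bounds are inductions on the ratio of
    consecutive central coefficients. *)
Lemma central_bin_le k : 'C(k.*2, k) ^ 2 * k.*2.+1 <= 4 ^ k.*2.
Proof.
elim: k => [|k IH]; first by rewrite bin0.
have E := central_binS k.
rewrite (_ : 4 ^ k.+1.*2 = 16 * 4 ^ k.*2); last by rewrite doubleS !expnS mulnA.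
move: E IH; move: (4 ^ k.*2) 'C(k.*2, k) 'C(k.+1.*2, k.+1) => a c d E IH.
rewrite -(leq_pmul2l (_ : 0 < k.+1 ^ 2)) ?expn_gt0 // [X in X <= _]mulnA -expnMn E.
rewrite !expnMn.
have h : (2 * k.*2.+1) ^ 2 * k.+1.*2.+1 <= 16 * k.+1 ^ 2 * k.*2.+1.
  rewrite doubleS -!addnn; nia.
have := leq_mul h IH; rewrite expnMn.
have : 0 < k.*2.+1 by [].
move: (k.*2.+1) (k.+1.*2.+1) => u v u0 H.
rewrite -(leq_pmul2r u0); move: H; rewrite !mulnA; nia.
Qed.

Lemma central_bin_ge k : 0 < k -> 4 ^ k.*2 <= 'C(k.*2, k) ^ 2 * (4 * k).
Proof.
case: k => // k _; elim: k => [|k IH] //.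
have E := central_binS k.+1.
rewrite (_ : 4 ^ k.+2.*2 = 16 * 4 ^ k.+1.*2); last by rewrite doubleS !expnS mulnA.
move: E IH; move: (4 ^ _) 'C(k.+1.*2, k.+1) 'C(k.+2.*2, k.+2) => a c d E IH.
rewrite -(leq_pmul2l (_ : 0 < k.+2 ^ 2)) ?expn_gt0 // [X in _ <= X]mulnA -expnMn E.
have h : 16 * k.+2 ^ 2 * (4 * k.+1) <= (2 * k.+1.*2.+1) ^ 2 * (4 * k.+2).
  rewrite doubleS -!addnn; nia.
have := leq_mul h IH; rewrite expnMn.
have : 0 < 4 * k.+1 by [].
move: (4 * k.+1) (4 * k.+2) => u v u0 H.
rewrite -(leq_pmul2r u0); move: H; rewrite !mulnA; nia.
Qed.

Lemma middle_bin_le n : 'C(n, n./2) ^ 2 * n.+1 <= 4 ^ n.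
Proof.
rewrite -(odd_double_half n); move: (n./2) => k; case: (odd n) => /=; last first.
  by rewrite !add0n doubleK central_bin_le.
rewrite add1n /= uphalf_double.
have s : 'C(k.*2.+1, k) = 'C(k.*2.+1, k.+1).
  by rewrite -[RHS]bin_sub -?addnn; [congr 'C(_, _); lia | lia].
rewrite s; have := central_bin_le k.+1; rewrite central_bin_half doubleS !expnS; nia.
Qed.

(** * The theorem *)

Local Open Scope ring_scope.

Theorem theorem2 (R : realType) :
  (exists (c1 c2 : R) (N : nat), [/\ 0 < c1, 0 < c2 &
    forall n : nat, (N <= n)%N -> ~~ odd n ->
      2 ^+ (n - 1) / 3 * (1 + c1 / Num.sqrt n%:R) <= (f n C4)%:R
        <= 2 ^+ (n - 1) / 3 * (1 + c2 / Num.sqrt n%:R)])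
  /\
  (exists c : R, 0 < c /\
    forall n : nat, (27 <= n)%N ->
      (2 : R) ^+ (n - 1) / 3 <= (f n C4)%:R
        <= 2 ^+ (n - 1) / 3 * (1 + c / Num.sqrt n%:R)).
Proof.
have pow n : (0 < n)%N -> (2 ^ n)%:R = 2 * 2 ^+ (n - 1) :> R.
  by case: n => // n _; rewrite natrX exprS subSS subn0.
have pow4 n : (0 < n)%N -> (4 ^ n)%:R = (2 * 2 ^+ (n - 1)) ^+ 2 :> R.
  by move=> n0; rewrite -pow // -natrX -expnM mulnC expnM.
have sq n : Num.sqrt n%:R ^+ 2 = n%:R :> R by rewrite sqr_sqrtr.
have sqgt n : (0 < n)%N -> 0 < Num.sqrt n%:R :> R.
  by move=> n0; rewrite sqrtr_gt0 ltr0n.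
have upper n : (0 < n)%N ->
    (f n C4)%:R <= 2 ^+ (n - 1) / 3 * (1 + 13 / Num.sqrt n%:R) :> R.
  move=> n0; have := f_C4_upper n; rewrite -(ler_nat R) natrD !natrM pow //.
  set p := 2 ^+ (n - 1); set b := 'C(n, n./2)%:R; set s := Num.sqrt n%:R => fu.
  have p0 : 0 < p by apply: exprn_gt0.
  have bs : b * s <= 2 * p.
    rewrite -(@ler_pXn2r R 2) // ?nnegrE ?mulr_ge0 ?ler0n ?sqrtr_ge0 ?(ltW p0) //.
    rewrite -pow4 // exprMn sq /b -natrX -natrM ler_nat.
    by apply: leq_trans (middle_bin_le n); rewrite leq_mul.
  have bs' : b <= 2 * p / s by rewrite ler_pdivlMr ?sqgt.
  have -> : p / 3 * (1 + 13 / s) = p / 3 + 13 / 6 * (2 * p / s) by field; rewrite gt_eqF ?sqgt.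
  lra.
split.
  (* The constant 1/6 comes from 18 f >= 3 * 2^n + 'C(n, n/2) and
     'C(n, n/2) >= 2^(n-1) / sqrt n. *)
  exists (6^-1), 13, 19%N; split; rewrite ?invr_gt0 ?ltr0n // => n n19 evn.
  rewrite upper ?andbT; last by apply: leq_trans n19.
  have n0 : (0 < n)%N by apply: leq_trans n19.
  have := f_C4_lower n19; rewrite (negPf evn) -(ler_nat R) natrD !natrM pow //.
  set p := 2 ^+ (n - 1); set b := 'C(n, n./2)%:R; set s := Num.sqrt n%:R => fl.
  have p0 : 0 < p by apply: exprn_gt0.
  have bs : p <= b * s.
    rewrite -(@ler_pXn2r R 2) // ?nnegrE ?mulr_ge0 ?ler0n ?sqrtr_ge0 ?(ltW p0) //.
    rewrite -(ler_pM2l (_ : 0 < 2 ^+ 2)) ?exprn_gt0 // -exprMn -pow4 //.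
    rewrite exprMn sq /b -!natrX -!natrM ler_nat.
    have k0 : (0 < n./2)%N by lia.
    have := central_bin_ge k0; rewrite even_halfK //; lia.
  have bs' : p / s <= b by rewrite ler_pdivrMr ?sqgt.
  have -> : p / 3 * (1 + 6^-1 / s) = p / 3 + 18^-1 * (p / s) by field; rewrite gt_eqF ?sqgt.
  lra.
exists 13; split=> [|n n27]; first by rewrite ltr0n.
have n0 : (0 < n)%N by apply: leq_trans n27.
rewrite upper // andbT.
have := f_C4_lower (leq_trans (isT : (18 < 27)%N) n27); rewrite -(ler_nat R) natrD !natrM pow //.
set b := (if _ then _ else _); have b0 : 0 <= b%:R :> R by apply: ler0n.
lra.
Qed.
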